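(* Let $N\ge 1$ and let $t^{\pm}(z)=\mathrm{tr}_0\,\mathcal{T}^{\pm}_0(z)\in\widehat{\mathcal U}_q^{\otimes N}[[z^{\pm2}]]$ be the universal transfer matrices of the closed chain. Then all the Cartan generators $\ell^{\pm}_{ii}$ of the finite quantum algebra $\mathcal U_q(gl(\mathcal N))$ (acting in $\widehat{\mathcal U}_q^{\otimes N}$ through the iterated coproduct) commute with the universal transfer matrix: writing $t(z)$ for either $t^+(z)$ or $t^-(z)$, $$[\ell^{\pm}_{ii},\,t(z)]=0,\qquad i=1,\dots,\mathcal N .$$ Thus they generate a $U(1)^{\mathcal N}$ symmetry algebra for the closed spin chain.
   Context: $\mathcal N\ge 2$ is an integer, $q$ is a nonzero complex deformation parameter with $q^2\neq1$, and $E_{ab}$ are the elementary $\mathcal N\times\mathcal N$ matrices. The $R$-matrix is $$R_{12}(z)=\mathfrak a(z)\sum_{a}E_{aa}\otimes E_{aa}+\mathfrak b(z)\sum_{a\ne b}E_{aa}\otimes E_{bb}+(q-q^{-1})\sum_{a\neq b}z^{\mathrm{sgn}(b-a)}E_{ab}\otimes E_{ba},$$ with $\mathfrak a(z)=qz-q^{-1}z^{-1}$, $\mathfrak b(z)=z-z^{-1}$. $\widehat{\mathcal U}_q=\mathcal U_q(\widehat{gl}(\mathcal N))$ at central charge $c=0$ is the algebra generated by $L^{(\pm n)}_{ab}$, $n\ge0$, $1\le a,b\le\mathcal N$, gathered in $\mathcal L^{\pm}(z)=\sum_{n\ge0}\sum_{a,b}z^{\pm2n}E_{ab}\otimes L_{ab}^{(\pm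 n)}$, with relations $$R_{12}(\tfrac zw)\mathcal L_1^{\pm}(z)\mathcal L_2^{\pm}(w)=\mathcal L_2^{\pm}(w)\mathcal L_1^{\pm}(z)R_{12}(\tfrac zw),\qquad R_{12}(\tfrac zw)\mathcal L_1^{+}(z)\mathcal L_2^{-}(w)=\mathcal L_2^{-}(w)\mathcal L_1^{+}(z)R_{12}(\tfrac zw),$$ and $L^{(+0)}_{ab}=L^{(-0)}_{ba}=0$ for $a<b$, $L^{(+0)}_{aa}L^{(-0)}_{aa}=L^{(-0)}_{aa}L^{(+0)}_{aa}=1$. The level-zero generators $\ell^{\mp}_{ab}:=L^{(\pm0)}_{ab}$ generate $\mathcal U_q(gl(\mathcal N))$; its Cartan generators are the $\ell^{\pm}_{ii}$. The coproduct is $\Delta(L^{\pm}_{ab}(z))=\sum_cL^{\pm}_{ac}(z)\otimes L^{\pm}_{cb}(z)$, and the universal monodromy matrices are $\mathcal T^{\pm}_0(z)=\Delta^{(N)}(\mathcal L^{\pm}(z))=\mathcal L^{\pm}_{01}(z)\mathcal L^{\pm}_{02}(z)\cdots\mathcal L^{\pm}_{0N}(z)$, where $0$ is the auxiliary space $\mathrm{End}(\mathbb C^{\mathcal N})$, $1,\dots,N$ label the copies of $\widehat{\mathcal U}_q$, and $\Delta^{(N)}$ is the iterated coproduct ($\Delta^{(1)}=\mathrm{id}$). The generators $\ell^{\pm}_{ii}$ are embedded in $\widehat{\mathcal U}_q^{\otimes N}$ as $\Delta^{(N)}(\ell^{\pm}_{ii})$, i.e. as the diagonal entries of $\mathcal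 T^{-}(\infty)$ and $\mathcal T^{+}(0)$ respectively. *)

(* Defs.v *)
From HB Require Import structures.
From mathcomp Require Import all_boot all_order all_algebra.
From mathcomp Require Import zify finmap boolp mxtens monalg.

Set Implicit Arguments.
Unset Strict Implicit.
Unset Printing Implicit Defensive.

Import GRing.Theory.

Local Open Scope ring_scope.
Local Open Scope quotient_scope.

(* Free associative unital algebra on X: monoid algebra of the words on X. *)
Definition freealg (K : fieldType) (X : choiceType) := {malg K[{fmonom X}]}.

Section FreeAlgebra.
Variables (K : fieldType) (X : choiceType).

HB.instance Definition _ := GRing.Lalgebra.on (freealg K X).

Lemma freealg_malgC_comm (k : K) (g : {malg K[{fmonom X}]}) :
  g * malgC k = malgC k * g.
Proof.
rewrite mul_malgC malgZ_def malgM_def fgmulgU.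
by apply: eq_bigr => x _; rewrite mulm1 mulrC.
Qed.

Lemma freealg_scalerAr (k : K) (x y : freealg K X) :
  k *: (x * y) = x * (k *: y).
Proof.
by rewrite -[k *: y]mul_malgC mulrA freealg_malgC_comm -mulrA mul_malgC.
Qed.

HB.instance Definition _ :=
  GRing.Lalgebra_isAlgebra.Build K (freealg K X) freealg_scalerAr.

Definition fvar (x : X) : freealg K X := mkmalgU (fmu x) 1.

Section Lift.
Variables (B : algType K) (h : X -> B).

Definition fword (m : {fmonom X}) : B := \prod_(x <- (m : seq X)) h x.

Lemma fword_mmorphism : mmorphism fword.
Proof. by split=> [x y|]; rewrite /fword ?fmM ?big_cat // fm1 big_nil. Qed.

HB.instance Definition _ :=
  isMultiplicative.Build {fmonom X} B fword fword_mmorphism.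

Definition flift : freealg K X -> B := mmap (in_alg B) fword.

Lemma flift_additive : zmod_morphism flift.
Proof. exact: mmap_is_additive. Qed.

Lemma flift_multiplicative : monoid_morphism flift.
Proof.
have [HM H1] : multiplicative flift.
  apply: commr_mmap_is_multiplicative => g m m' /=.
  by rewrite /GRing.comm -scalerAl mul1r -scalerAr mulr1.
by split.
Qed.

Lemma flift_scalable : scalable flift.
Proof. by move=> k g; rewrite /flift mmapZ /= -scalerAl mul1r. Qed.

HB.instance Definition _ :=
  GRing.isZmodMorphism.Build (freealg K X) B flift flift_additive.
HB.instance Definition _ :=
  GRing.isMonoidMorphism.Build (freealg K X) B flift flift_multiplicative.
HB.instance Definition _ :=
  GRing.isScalable.Build K (freealg K X) B *:%R flift flift_scalable.

Lemma fliftV x : flift (fvar x) = h x.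
Proof.
by rewrite /flift /fvar mmapU /= scale1r mul1r /fword fmU big_seq1.
Qed.
End Lift.

End FreeAlgebra.

(* An algType must be nonzero; a counit is the certificate used below to check
   this for algebras given by generators and relations. *)
HB.mixin Record hasCounit (K : fieldType) A of GRing.Algebra K A := {
  counit : {lrmorphism A -> K^o}
}.
#[short(type="augAlgType")]
HB.structure Definition AugAlgebra (K : fieldType) :=
  {A of GRing.Algebra K A & hasCounit K A}.

(* The operations below are locked: unfolding them during unification is
   prohibitively slow. *)
Fact lock_key : unit. Proof. by []. Qed.

Section IdealQuotient.
Variables (K : fieldType) (A : algType K) (S : A -> Prop).

(* Two-sided ideal generated by S. *)
Inductive ideal_gen : A -> Prop :=
| ideal_gen_in x of S x : ideal_gen x
| ideal_gen0 : ideal_gen 0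
| ideal_genD x y of ideal_gen x & ideal_gen y : ideal_gen (x + y)
| ideal_genMl a x of ideal_gen x : ideal_gen (a * x)
| ideal_genMr a x of ideal_gen x : ideal_gen (x * a).

Lemma ideal_genN x : ideal_gen x -> ideal_gen (- x).
Proof. by rewrite -mulN1r; apply: ideal_genMl. Qed.

Lemma ideal_genB x y : ideal_gen x -> ideal_gen y -> ideal_gen (x - y).
Proof. by move=> hx hy; apply: ideal_genD => //; apply: ideal_genN. Qed.

Lemma ideal_genZ k x : ideal_gen x -> ideal_gen (k *: x).
Proof. by rewrite -[x in k *: x]mul1r scalerAl; apply: ideal_genMl. Qed.

Definition ideal_rel (x y : A) := `[< ideal_gen (x - y) >].

Lemma ideal_rel_equiv : equiv_class_of ideal_rel.
Proof.
split=> [x|x y|y x z].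
- by apply/asboolP; rewrite subrr; apply: ideal_gen0.
- by apply/asboolP/asboolP => /ideal_genN; rewrite opprB.
- move=> /asboolP xy /asboolP yz; apply/asboolP.
  by rewrite -[x](subrK y) -addrA; apply: ideal_genD.
Qed.

Canonical ideal_equiv := EquivRelPack ideal_rel_equiv.

Variables (eps : {lrmorphism A -> K^o}) (epsS : forall x, S x -> eps x = 0).

Lemma ideal_gen_morph (B : algType K) (f : {lrmorphism A -> B}) :
  (forall x, S x -> f x = 0) -> forall x, ideal_gen x -> f x = 0.
Proof.
move=> fS x; elim=> {x} [x Sx||x y _ hx _ hy|a x _ hx|a x _ hx].
- exact: fS.
- exact: rmorph0.
- by rewrite rmorphD /= hx hy addr0.
- by rewrite rmorphM /= hx mulr0.
- by rewrite rmorphM /= hx mul0r.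
Qed.

(* The algebra A / (S). The argument epsS only serves to prove 1 != 0. *)
Definition quotalg of (forall x, S x -> eps x = 0) := {eq_quot ideal_equiv}.
Local Notation Q := (quotalg epsS).

HB.instance Definition _ := Choice.on Q.
HB.instance Definition _ := EqQuotient.on Q.

Definition quot_pi (x : A) : Q := \pi_Q x.

Lemma quot_piP x y : quot_pi x = quot_pi y <-> ideal_gen (x - y).
Proof.
split=> [h|h].
- by apply/asboolP; have /eqmodP := h.
- by apply/eqmodP; apply/asboolP.
Qed.

Lemma quot_piK (u : Q) : quot_pi (repr u) = u.
Proof. exact: reprK. Qed.

Lemma quot_ind (P : Q -> Prop) : (forall x, P (quot_pi x)) -> forall u, P u.
Proof. by move=> h u; rewrite -[u]quot_piK. Qed.

Definition quot_zero : Q := quot_pi 0.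
Definition quot_one : Q := quot_pi 1.
Definition quot_opp : Q -> Q :=
  locked_with lock_key (fun u => quot_pi (- repr u)).
Definition quot_add : Q -> Q -> Q :=
  locked_with lock_key (fun u v => quot_pi (repr u + repr v)).
Definition quot_mul : Q -> Q -> Q :=
  locked_with lock_key (fun u v => quot_pi (repr u * repr v)).
Definition quot_scale : K -> Q -> Q :=
  locked_with lock_key (fun k u => quot_pi (k *: repr u)).

Lemma repr_quot_pi x : ideal_gen (repr (quot_pi x) - x).
Proof. by apply/quot_piP; rewrite quot_piK. Qed.

Lemma quot_oppE x : quot_opp (quot_pi x) = quot_pi (- x).
Proof.
rewrite /quot_opp unlock.
apply/quot_piP; rewrite -opprD; apply: ideal_genN; exact: repr_quot_pi.
Qed.

Lemma quot_addE x y : quot_add (quot_pi x) (quot_pi y) = quot_pi (x + y).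
Proof.
rewrite /quot_add unlock.
apply/quot_piP; rewrite opprD addrACA.
by apply: ideal_genD; apply: repr_quot_pi.
Qed.

Lemma quot_mulE x y : quot_mul (quot_pi x) (quot_pi y) = quot_pi (x * y).
Proof.
rewrite /quot_mul unlock.
apply/quot_piP; set x' := repr _; set y' := repr _.
have -> : x' * y' - x * y = (x' - x) * y' + x * (y' - y).
  by rewrite mulrBl mulrBr addrA subrK.
apply: ideal_genD; [apply: ideal_genMr|apply: ideal_genMl];
  exact: repr_quot_pi.
Qed.

Lemma quot_scaleE k x : quot_scale k (quot_pi x) = quot_pi (k *: x).
Proof.
rewrite /quot_scale unlock.
by apply/quot_piP; rewrite -scalerBr; apply: ideal_genZ; apply: repr_quot_pi.
Qed.

Let qE := (quot_addE, quot_mulE, quot_oppE, quot_scaleE).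

Lemma quot_addA : associative quot_add.
Proof. by do 3!elim/quot_ind => ?; rewrite !qE addrA. Qed.
Lemma quot_addC : commutative quot_add.
Proof. by do 2!elim/quot_ind => ?; rewrite !qE addrC. Qed.
Lemma quot_add0 : left_id quot_zero quot_add.
Proof. by elim/quot_ind => ?; rewrite !qE add0r. Qed.
Lemma quot_addN : left_inverse quot_zero quot_opp quot_add.
Proof. by elim/quot_ind => ?; rewrite !qE addNr. Qed.

HB.instance Definition _ :=
  GRing.isZmodule.Build Q quot_addA quot_addC quot_add0 quot_addN.

Lemma quot_mulA : associative quot_mul.
Proof. by do 3!elim/quot_ind => ?; rewrite !qE mulrA. Qed.
Lemma quot_mul1 : left_id quot_one quot_mul.
Proof. by elim/quot_ind => ?; rewrite !qE mul1r. Qed.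
Lemma quot_mulr1 : right_id quot_one quot_mul.
Proof. by elim/quot_ind => ?; rewrite !qE mulr1. Qed.
Lemma quot_mulDl : left_distributive quot_mul quot_add.
Proof. by do 3!elim/quot_ind => ?; rewrite !qE mulrDl. Qed.
Lemma quot_mulDr : right_distributive quot_mul quot_add.
Proof. by do 3!elim/quot_ind => ?; rewrite !qE mulrDr. Qed.
Lemma quot_one_neq0 : quot_one != quot_zero.
Proof.
apply/eqP => /quot_piP; rewrite subr0 => /(ideal_gen_morph epsS).
by rewrite rmorph1 => /eqP; rewrite oner_eq0.
Qed.

HB.instance Definition _ := GRing.Zmodule_isNzRing.Build Q
  quot_mulA quot_mul1 quot_mulr1 quot_mulDl quot_mulDr quot_one_neq0.

Lemma quot_scaleA k l u : quot_scale k (quot_scale l u) = quot_scale (k * l) u.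
Proof. by elim/quot_ind: u => ?; rewrite !qE scalerA. Qed.
Lemma quot_scale1 : left_id 1 quot_scale.
Proof. by elim/quot_ind => ?; rewrite !qE scale1r. Qed.
Lemma quot_scaleDr : right_distributive quot_scale quot_add.
Proof. by move=> k; do 2!elim/quot_ind => ?; rewrite !qE scalerDr. Qed.
Lemma quot_scaleDl u : {morph quot_scale^~ u : k l / k + l >-> quot_add k l}.
Proof. by move=> k l; elim/quot_ind: u => ?; rewrite !qE scalerDl. Qed.

HB.instance Definition _ := GRing.Zmodule_isLmodule.Build K Q
  quot_scaleA quot_scale1 quot_scaleDr quot_scaleDl.

Lemma quot_scaleAl k (u v : Q) : k *: (u * v) = (k *: u) * v.
Proof.
elim/quot_ind: u => x; elim/quot_ind: v => y.
by rewrite /GRing.scale /GRing.mul /= !qE scalerAl.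
Qed.

HB.instance Definition _ := GRing.Lmodule_isLalgebra.Build K Q quot_scaleAl.

Lemma quot_scaleAr k (u v : Q) : k *: (u * v) = u * (k *: v).
Proof.
elim/quot_ind: u => x; elim/quot_ind: v => y.
by rewrite /GRing.scale /GRing.mul /= !qE scalerAr.
Qed.

HB.instance Definition _ := GRing.Lalgebra_isAlgebra.Build K Q quot_scaleAr.

Lemma quot_pi_zmod : zmod_morphism quot_pi.
Proof. by move=> x y; rewrite /GRing.add /GRing.opp /= !qE. Qed.
Lemma quot_pi_monoid : monoid_morphism quot_pi.
Proof. by split=> // x y; rewrite /GRing.mul /= !qE. Qed.
Lemma quot_pi_scalable : scalable quot_pi.
Proof. by move=> k x; rewrite /GRing.scale /= !qE. Qed.

HB.instance Definition _ :=
  GRing.isZmodMorphism.Build A Q quot_pi quot_pi_zmod.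
HB.instance Definition _ :=
  GRing.isMonoidMorphism.Build A Q quot_pi quot_pi_monoid.
HB.instance Definition _ :=
  GRing.isScalable.Build K A Q *:%R quot_pi quot_pi_scalable.

Lemma quot_pi_eq0 x : S x -> quot_pi x = 0.
Proof. by move=> Sx; apply/quot_piP; rewrite subr0; apply: ideal_gen_in. Qed.

Section Lift.
Variables (B : algType K) (f : {lrmorphism A -> B}).
Variable fS : forall x, S x -> f x = 0.

Definition quot_lift of (forall x, S x -> f x = 0) : Q -> B :=
  locked_with lock_key (fun u : Q => f (repr u)).
Local Notation g := (quot_lift fS).

Lemma quot_liftE x : g (quot_pi x) = f x.
Proof.
rewrite /quot_lift unlock.
apply/eqP; rewrite -subr_eq0 -rmorphB; apply/eqP.
exact: (ideal_gen_morph fS (repr_quot_pi x)).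
Qed.

Lemma quot_lift_zmod : zmod_morphism g.
Proof.
elim/quot_ind => x; elim/quot_ind => y.
by rewrite -rmorphB !quot_liftE rmorphB.
Qed.
Lemma quot_lift_monoid : monoid_morphism g.
Proof.
split; first by rewrite -(rmorph1 quot_pi) quot_liftE rmorph1.
elim/quot_ind => x; elim/quot_ind => y.
by rewrite -rmorphM !quot_liftE rmorphM.
Qed.
Lemma quot_lift_scalable : scalable g.
Proof.
by move=> k; elim/quot_ind => x; rewrite -linearZ !quot_liftE linearZ.
Qed.

HB.instance Definition _ :=
  GRing.isZmodMorphism.Build Q B g quot_lift_zmod.
HB.instance Definition _ :=
  GRing.isMonoidMorphism.Build Q B g quot_lift_monoid.
HB.instance Definition _ :=
  GRing.isScalable.Build K Q B *:%R g quot_lift_scalable.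
End Lift.

HB.instance Definition _ := hasCounit.Build K Q (quot_lift epsS).

End IdealQuotient.

Section Tensor.
Variables (K : fieldType) (A B : augAlgType K).

Local Notation X := (fun a b => fvar K (a, b)).

(* Relations between the pure tensors a (x) b in the tensor product of the
   algebras A and B. *)
Inductive tens_rel : freealg K (A * B)%type -> Prop :=
| TensMul a a' b b' :
    tens_rel (X (a : A) (b : B) * X a' b' - X (a * a') (b * b'))
| TensOne : tens_rel (X (1 : A) (1 : B) - 1)
| TensLinL k a a' b :
    tens_rel (X (k *: a + a' : A) (b : B) - (k *: X a b + X a' b))
| TensLinR k a b b' :
    tens_rel (X (a : A) (k *: b + b' : B) - (k *: X a b + X a b')).

Section Lift.
Variables (C : algType K) (f : {lrmorphism A -> C}) (g : {lrmorphism B -> C}).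
Hypothesis fg : forall a b, f a * g b = g b * f a.

Definition tens_free : {lrmorphism freealg K (A * B)%type -> C} :=
  flift (fun ab : A * B => f ab.1 * g ab.2).

Lemma tens_freeP x : tens_rel x -> tens_free x = 0.
Proof.
rewrite /tens_free /=; case=> [a a' b b'||k a a' b|k a b b'].
- rewrite rmorphB rmorphM /= !fliftV /= !rmorphM -!mulrA (mulrA (g b)) -fg.
  by rewrite -!mulrA subrr.
- by rewrite rmorphB /= !fliftV /= !rmorph1 mul1r subrr.
- rewrite linearB !linearP /= !fliftV /= linearP /= mulrDl -scalerAl.
  by rewrite scalerN -opprD subrr.
- rewrite linearB !linearP /= !fliftV /= linearP /= mulrDr -scalerAr.
  by rewrite scalerN -opprD subrr.
Qed.
End Lift.

Lemma counit_comm (a : A) (b : B) :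
  counit a * counit b = counit b * counit a :> K^o.
Proof. exact: mulrC. Qed.

Definition tens : augAlgType K := quotalg (tens_freeP counit_comm).

Definition pure : A -> B -> tens :=
  locked_with lock_key (fun a b => quot_pi _ (fvar K (a, b))).

Lemma pureE a b : pure a b = quot_pi _ (fvar K (a, b)).
Proof. by rewrite /pure unlock. Qed.

Lemma pureM a a' b b' : pure a b * pure a' b' = pure (a * a') (b * b').
Proof.
have /eqP := quot_pi_eq0 (tens_freeP counit_comm) (TensMul a a' b b').
by rewrite rmorphB rmorphM subr_eq0 !pureE => /eqP.
Qed.
Lemma pure1 : pure 1 1 = 1.
Proof.
have /eqP := quot_pi_eq0 (tens_freeP counit_comm) TensOne.
by rewrite rmorphB rmorph1 subr_eq0 !pureE => /eqP.
Qed.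
Lemma pure_linl k a a' b : pure (k *: a + a') b = k *: pure a b + pure a' b.
Proof.
have /eqP := quot_pi_eq0 (tens_freeP counit_comm) (TensLinL k a a' b).
by rewrite rmorphB /= linearP subr_eq0 !pureE => /eqP.
Qed.
Lemma pure_linr k a b b' : pure a (k *: b + b') = k *: pure a b + pure a b'.
Proof.
have /eqP := quot_pi_eq0 (tens_freeP counit_comm) (TensLinR k a b b').
by rewrite rmorphB /= linearP subr_eq0 !pureE => /eqP.
Qed.

Definition inl_tens (a : A) : tens := pure a 1.
Definition inr_tens (b : B) : tens := pure 1 b.

Lemma inl_tens_linear : linear inl_tens.
Proof. by move=> k x y; apply: pure_linl. Qed.
Lemma inl_tens_monoid : monoid_morphism inl_tens.
Proof. by split=> [|x y]; rewrite /inl_tens ?pure1 // pureM mulr1. Qed.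
Lemma inr_tens_linear : linear inr_tens.
Proof. by move=> k x y; apply: pure_linr. Qed.
Lemma inr_tens_monoid : monoid_morphism inr_tens.
Proof. by split=> [|x y]; rewrite /inr_tens ?pure1 // pureM mulr1. Qed.
HB.instance Definition _ :=
  GRing.isLinear.Build K A tens *:%R inl_tens inl_tens_linear.
HB.instance Definition _ :=
  GRing.isMonoidMorphism.Build A tens inl_tens inl_tens_monoid.
HB.instance Definition _ :=
  GRing.isLinear.Build K B tens *:%R inr_tens inr_tens_linear.
HB.instance Definition _ :=
  GRing.isMonoidMorphism.Build B tens inr_tens inr_tens_monoid.

Lemma inlr_tens a b : inl_tens a * inr_tens b = pure a b.
Proof. by rewrite pureM mulr1 mul1r. Qed.
Lemma inrl_tens a b : inr_tens b * inl_tens a = pure a b.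
Proof. by rewrite pureM mulr1 mul1r. Qed.

End Tensor.
Arguments inl_tens {K A} B.
Arguments inr_tens {K} A {B}.
Arguments counit_comm {K A B}.

Section TensorLift.
Variables (K : fieldType) (A B : augAlgType K) (C : algType K).
Variables (f : {lrmorphism A -> C}) (g : {lrmorphism B -> C}).
Hypothesis fg : forall a b, f a * g b = g b * f a.

Definition tens_lift : {lrmorphism tens A B -> C} :=
  quot_lift (epsS := tens_freeP counit_comm) (tens_freeP fg).

Lemma tens_liftE a b : tens_lift (pure a b) = f a * g b.
Proof.
rewrite /tens_lift pureE /=.
have := quot_liftE (tens_freeP counit_comm) (tens_freeP fg) (fvar K (a, b)).
by rewrite /= fliftV /= => <-.
Qed.
End TensorLift.

Section TensorMap.
Variables (K : fieldType) (A A' B B' : augAlgType K).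
Variables (f : {lrmorphism A -> A'}) (g : {lrmorphism B -> B'}).

Lemma tens_map_comm a b :
  (inl_tens B' \o f) a * (inr_tens A' \o g) b =
  (inr_tens A' \o g) b * (inl_tens B' \o f) a.
Proof. by rewrite /= inlr_tens inrl_tens. Qed.

(* f (x) g *)
Definition tens_map : {lrmorphism tens A B -> tens A' B'} :=
  tens_lift tens_map_comm.

Lemma tens_mapE a b : tens_map (pure a b) = pure (f a) (g b).
Proof. by rewrite /tens_map tens_liftE /= inlr_tens. Qed.
End TensorMap.

(* A sign s : bool stands for + (true) or - (false). *)

Section RTT.
Variables (K : fieldType) (n : nat) (q : K).

Local Notation E a b := (delta_mx a b : 'M[K]_n).

(* Coefficients of z ^ k in a(z), b(z) and R(z). *)
Definition acoef (k : int) : K := q *+ (k == 1) - q^-1 *+ (k == -1).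
Definition bcoef (k : int) : K := (k == 1)%:R - (k == -1)%:R.
Definition Rcoef (k : int) : 'M[K]_(n * n) :=
  acoef k *: (\sum_(a < n) E a a *t E a a)
  + bcoef k *: (\sum_(a < n) \sum_(b < n | a != b) E a a *t E b b)
  + (q - q^-1) *: (\sum_(a < n) \sum_(b < n | a != b)
      (k == sgz (b%:Z - a%:Z))%:R *: (E a b *t E b a)).

Section InAlgebra.
(* L s m is the matrix (L^(s m)_ab)_ab. *)
Variables (A : algType K) (L : bool -> nat -> 'M[A]_n).

(* Coefficient of z ^ i in L^s(z) = \sum_m z^(s 2m) L^(s m). *)
Definition Lcoef (s : bool) (i : int) : 'M[A]_n :=
  if (if s then i else - i) is Posz p then
    if odd p then 0 else L s p./2
  else 0.

Definition RA (k : int) : 'M[A]_(n * n) := map_mx (in_alg A) (Rcoef k).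
Definition emb1 (M : 'M[A]_n) : 'M[A]_(n * n) := M *t 1%:M.
Definition emb2 (M : 'M[A]_n) : 'M[A]_(n * n) := 1%:M *t M.

(* Coefficients of z ^ i w ^ j in R12(z/w) L1^s(z) L2^s'(w) and in
   L2^s'(w) L1^s(z) R12(z/w); only (z/w) ^ 1 and (z/w) ^ -1 occur in R. *)
Definition RLL (s s' : bool) (i j : int) : 'M[A]_(n * n) :=
  \sum_(k <- [:: 1; -1] : seq int)
    RA k *m emb1 (Lcoef s (i - k)) *m emb2 (Lcoef s' (j + k)).
Definition LLR (s s' : bool) (i j : int) : 'M[A]_(n * n) :=
  \sum_(k <- [:: 1; -1] : seq int)
    emb2 (Lcoef s' (j + k)) *m emb1 (Lcoef s (i - k)) *m RA k.

(* The defining relations, each written as an element to be set to 0. *)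
Inductive Uq_rel : A -> Prop :=
| UqRTT s s' i j x y of
    (s, s') \in [:: (true, true); (false, false); (true, false)] :
    Uq_rel ((RLL s s' i j - LLR s s' i j) x y)
| UqLow (a b : 'I_n) of (a < b)%N : Uq_rel (L true 0%N a b)
| UqUp (a b : 'I_n) of (a < b)%N : Uq_rel (L false 0%N b a)
| UqInvr (a : 'I_n) : Uq_rel (L true 0%N a a * L false 0%N a a - 1)
| UqInvl (a : 'I_n) : Uq_rel (L false 0%N a a * L true 0%N a a - 1).

End InAlgebra.

Lemma RLL_map (A B : algType K) (f : {lrmorphism A -> B})
    (L : bool -> nat -> 'M[A]_n) s s' i j :
  map_mx f (RLL L s s' i j - LLR L s s' i j) =
  RLL (fun s m => map_mx f (L s m)) s s' i j
  - LLR (fun s m => map_mx f (L s m)) s s' i j.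
Proof.
have fL t k : map_mx f (Lcoef L t k) =
    Lcoef (fun s m => map_mx f (L s m)) t k.
  by rewrite /Lcoef; case: (if t then _ else _) => p; rewrite ?(fun_if (map_mx f))
    ?map_mx0.
have fR k : map_mx f (RA A k) = RA B k.
  by apply/matrixP => x y; rewrite !mxE /= linearZ /= rmorph1.
have f1 M : map_mx f (emb1 M) = emb1 (map_mx f M).
  by rewrite /emb1 map_mxT map_mx1.
have f2 M : map_mx f (emb2 M) = emb2 (map_mx f M).
  by rewrite /emb2 map_mxT map_mx1.
rewrite map_mxB /RLL /LLR !big_cons !big_nil !map_mxD !map_mxM !map_mx0.
by rewrite !f1 !f2 !fR !fL.
Qed.

Lemma Uq_rel_map (A B : algType K) (f : {lrmorphism A -> B})
    (L : bool -> nat -> 'M[A]_n) x :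
  Uq_rel L x -> Uq_rel (fun s m => map_mx f (L s m)) (f x).
Proof.
have fE s m a b : f (L s m a b) = map_mx f (L s m) a b by rewrite mxE.
case=> [s s' i j u v H|a b H|a b H|a|a].
- have -> : f ((RLL L s s' i j - LLR L s s' i j) u v) =
            map_mx f (RLL L s s' i j - LLR L s s' i j) u v by rewrite [RHS]mxE.
  by rewrite RLL_map; apply: UqRTT.
- by rewrite fE; exact: (UqLow (fun s m => map_mx f (L s m)) H).
- by rewrite fE; exact: (UqUp (fun s m => map_mx f (L s m)) H).
- rewrite rmorphB rmorphM rmorph1 /= !fE.
  exact: (UqInvr (fun s m => map_mx f (L s m))).
- rewrite rmorphB rmorphM rmorph1 /= !fE.
  exact: (UqInvl (fun s m => map_mx f (L s m))).
Qed.

Lemma Uq_rel_map_inv (A B : algType K) (f : {lrmorphism A -> B})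
    (L : bool -> nat -> 'M[A]_n) x :
  Uq_rel (fun s m => map_mx f (L s m)) x -> exists2 y, Uq_rel L y & x = f y.
Proof.
case=> [s s' i j u v H|a b H|a b H|a|a].
- exists ((RLL L s s' i j - LLR L s s' i j) u v); first exact: UqRTT.
  by rewrite -RLL_map mxE.
- by exists (L true 0%N a b); [exact: UqLow|rewrite mxE].
- by exists (L false 0%N b a); [exact: UqUp|rewrite mxE].
- exists (L true 0%N a a * L false 0%N a a - 1); first exact: UqInvr.
  by rewrite rmorphB rmorphM rmorph1 !mxE.
- exists (L false 0%N a a * L true 0%N a a - 1); first exact: UqInvl.
  by rewrite rmorphB rmorphM rmorph1 !mxE.
Qed.

Lemma Uq_rel_ext (A : algType K) (L L' : bool -> nat -> 'M[A]_n) x :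
  (forall s m, L s m = L' s m) -> Uq_rel L x -> Uq_rel L' x.
Proof.
by move=> h; have -> : L = L' by apply/funext => s; apply/funext => m.
Qed.

(* Generators L^(s m)_ab are indexed by (s, m, a, b). *)
Definition Uq_idx := (bool * nat * 'I_n * 'I_n)%type.

Definition Uq_free (s : bool) (m : nat) : 'M[freealg K Uq_idx]_n :=
  \matrix_(a, b) fvar K ((s, m, a, b) : Uq_idx).

Lemma Uq_freeP (A : algType K) (L : bool -> nat -> 'M[A]_n) :
  (forall x, Uq_rel L x -> x = 0) ->
  forall x, Uq_rel Uq_free x ->
    flift (fun g : Uq_idx => L g.1.1.1 g.1.1.2 g.1.2 g.2) x = 0.
Proof.
move=> H x /(Uq_rel_map (flift (fun g : Uq_idx => L g.1.1.1 g.1.1.2 g.1.2 g.2))).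
move/(Uq_rel_ext (L' := L)) => h; apply: H; apply: h => s m.
by apply/matrixP => a b; rewrite !mxE /= fliftV.
Qed.

Definition Uq_counit (s : bool) (m : nat) : 'M[K^o]_n :=
  if m == 0%N then 1%:M else 0.

Lemma Uq_counitP x : Uq_rel Uq_counit x -> x = 0.
Proof.
case=> [s s' i j u v _|a b ab|a b ab|a|a]; rewrite /Uq_counit /=.
- suff -> : RLL Uq_counit s s' i j = LLR Uq_counit s s' i j by rewrite subrr mxE.
  apply: eq_bigr => k _.
  have C t l : exists c : K^o, Lcoef Uq_counit t l = c%:M.
    rewrite /Lcoef; case: (if t then _ else _) => p;
      last by exists 0; rewrite raddf0.
    case: ifP => _; first by exists 0; rewrite raddf0.
    rewrite /Uq_counit; case: ifP => _; first by exists 1.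
    by exists 0; rewrite raddf0.
  have [c ->] := C s (i - k); have [d ->] := C s' (j + k).
  have e1 (e : K^o) : emb1 (e%:M) = e%:M :> 'M[K^o]_(n * n).
    apply/matrixP => x1 y1; case: (mxtens_indexP x1) => i1 j1.
    case: (mxtens_indexP y1) => k1 l1; rewrite tensmxE !mxE.
    rewrite (can_eq (@mxtens_indexK n n)) xpair_eqE.
    by case: eqP => _; case: eqP => _; rewrite ?mulr1 ?mulr0 ?mul0r.
  have e2 (e : K^o) : emb2 (e%:M) = e%:M :> 'M[K^o]_(n * n).
    apply/matrixP => x1 y1; case: (mxtens_indexP x1) => i1 j1.
    case: (mxtens_indexP y1) => k1 l1; rewrite tensmxE !mxE.
    rewrite (can_eq (@mxtens_indexK n n)) xpair_eqE.
    by case: eqP => _; case: eqP => _; rewrite ?mul1r ?mulr0 ?mul0r.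
  rewrite e1 e2 -scalar_mxM mul_scalar_mx -mulmxA -scalar_mxM mul_mx_scalar.
  by rewrite mulrC.
- by rewrite mxE -val_eqE /= ltn_eqF.
- by rewrite mxE -val_eqE /= gtn_eqF.
- by rewrite !mxE eqxx mulr1 subrr.
- by rewrite !mxE eqxx mulr1 subrr.
Qed.

(* U_q(gl^(n)) at c = 0. *)
Definition Uq : augAlgType K := quotalg (Uq_freeP Uq_counitP).

(* Lgen s m a b is the generator L^(s m)_ab. *)
Definition Lgen : bool -> nat -> 'M[Uq]_n := locked_with lock_key
  (fun s m => map_mx (quot_pi (Uq_freeP Uq_counitP)) (Uq_free s m)).

Lemma LgenP x : Uq_rel Lgen x -> x = 0.
Proof.
rewrite /Lgen unlock.
by move=> /(Uq_rel_map_inv (f := quot_pi (Uq_freeP Uq_counitP))) [y Ly ->];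
  apply: quot_pi_eq0.
Qed.

Section Lift.
Variables (A : algType K) (L : bool -> nat -> 'M[A]_n).
Hypothesis HL : forall x, Uq_rel L x -> x = 0.

Definition Uq_lift : {lrmorphism Uq -> A} :=
  quot_lift (epsS := Uq_freeP Uq_counitP) (Uq_freeP HL).

Lemma Uq_liftE s m a b : Uq_lift (Lgen s m a b) = L s m a b.
Proof.
rewrite /Uq_lift /Lgen unlock /= mxE [Uq_free _ _ _ _]mxE.
have := quot_liftE (Uq_freeP Uq_counitP) (Uq_freeP HL)
  (fvar K ((s, m, a, b) : Uq_idx)).
by rewrite /= fliftV /= => <-.
Qed.
End Lift.

End RTT.


(* Multiplication by the d-th power of the variable, on the coefficients. *)
Definition shiftc (V : nmodType) (d : bool) (F : nat -> V) (m : nat) : V :=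
  if d then (if m is p.+1 then F p else 0) else F m.

(* Whether the k-th term of R(z/w) raises the exponent of the variable z^(s 2). *)
Definition raises (s : bool) (k : int) : bool := s == (k == 1).

Section Coproduct.
Variables (K : fieldType) (n : nat) (q : K).

Section Embeddings.
Variable A : algType K.
Implicit Types X Y : 'M[A]_n.

Lemma emb1_zmod : zmod_morphism (@emb1 K n A).
Proof. by move=> X Y; apply/matrixP => i j; rewrite !mxE mulrBl. Qed.
Lemma emb2_zmod : zmod_morphism (@emb2 K n A).
Proof. by move=> X Y; apply/matrixP => i j; rewrite !mxE mulrBr. Qed.
HB.instance Definition _ :=
  GRing.isZmodMorphism.Build 'M[A]_n 'M[A]_(n * n) (@emb1 K n A) emb1_zmod.
HB.instance Definition _ :=
  GRing.isZmodMorphism.Build 'M[A]_n 'M[A]_(n * n) (@emb2 K n A) emb2_zmod.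

Lemma emb1_sum m (F : 'I_m -> 'M[A]_n) :
  emb1 (\sum_i F i) = \sum_i emb1 (F i).
Proof. exact: raddf_sum. Qed.
Lemma emb2_sum m (F : 'I_m -> 'M[A]_n) :
  emb2 (\sum_i F i) = \sum_i emb2 (F i).
Proof. exact: raddf_sum. Qed.

Lemma sum_mxtens (V : nmodType) (F : 'I_(n * n) -> V) :
  \sum_x F x = \sum_i \sum_j F (mxtens_index (i, j)).
Proof.
rewrite pair_big /= (reindex (@mxtens_index n n)).
  by apply: eq_bigr => -[].
by exists (@mxtens_unindex n n) => x _; rewrite ?mxtens_indexK ?mxtens_unindexK.
Qed.

Lemma emb1M X Y : emb1 (X *m Y) = emb1 X *m emb1 Y.
Proof.
apply/matrixP => x y; case: (mxtens_indexP x) => i j.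
case: (mxtens_indexP y) => k l.
rewrite tensmxE !mxE sum_mxtens mulr_suml; apply: eq_bigr => a _.
rewrite (bigD1 j) //= big1 => [|b ne]; rewrite !tensmxE !mxE.
  by rewrite eqxx mulr1 addr0 mulrA.
by rewrite eq_sym (negPf ne) mulr0 mul0r.
Qed.

Lemma emb2M X Y : emb2 (X *m Y) = emb2 X *m emb2 Y.
Proof.
apply/matrixP => x y; case: (mxtens_indexP x) => i j.
case: (mxtens_indexP y) => k l.
rewrite tensmxE !mxE sum_mxtens exchange_big mulr_sumr.
apply: eq_bigr => a _.
rewrite (bigD1 i) //= big1 => [|b ne]; rewrite !tensmxE !mxE.
  rewrite eqxx mul1r addr0; case: eqP => _; rewrite ?mul1r ?mul0r ?mulr0 //.
by rewrite eq_sym (negPf ne) !mul0r.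
Qed.

Lemma emb12C X Y : (forall a b c d, X a b * Y c d = Y c d * X a b) ->
  emb1 X *m emb2 Y = emb2 Y *m emb1 X.
Proof.
move=> XY; apply/matrixP => x y; case: (mxtens_indexP x) => i j.
case: (mxtens_indexP y) => k l; rewrite !mxE !sum_mxtens.
rewrite (bigD1 k) //= (bigD1 j) //= big1 => [|b nb]; last first.
  by rewrite !tensmxE !mxE eq_sym (negPf nb) mulr0 mul0r.
rewrite big1 ?addr0 => [|a na]; last first.
  by rewrite big1 // => b _; rewrite !tensmxE !mxE (negPf na) mul0r mulr0.
rewrite [RHS](bigD1 i) //= (bigD1 l) //= big1 => [|b nb]; last first.
  by rewrite !tensmxE !mxE (negPf nb) !mulr0.
rewrite big1 ?addr0 => [|a na]; last first.
  rewrite big1 // => b _; rewrite !tensmxE !mxE eq_sym (negPf na).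
  by rewrite !mul0r.
by rewrite !tensmxE !mxE !eqxx !mulr1 !mul1r XY.
Qed.
End Embeddings.

Lemma sum_shift (U V W : nmodType) (f : U -> V -> W) d F G m :
  (forall v, f 0 v = 0) -> (forall u, f u 0 = 0) ->
  \sum_(i < m.+1) f (shiftc d F i) (G (m - i)%N) =
  \sum_(i < m.+1) f (F i) (shiftc d G (m - i)%N).
Proof.
move=> f0 f0'; case: d => //=.
rewrite big_ord_recl f0 add0r big_ord_recr /= subnn f0' addr0.
by apply: eq_bigr => i _ /=; rewrite /bump /= add1n subnS; case: (m - i)%N
  (subn_gt0 i m) => [|p] //=; rewrite ltn_ord.
Qed.

Section Conv.
Variables (A : algType K).
Implicit Types (F : nat -> 'M[A]_n) (L P Q : bool -> nat -> 'M[A]_n).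

Definition convm F G (m : nat) : 'M[A]_n := \sum_(i < m.+1) F i *m G (m - i)%N.

Lemma sh_conv d F G m :
  shiftc d (convm F G) m = \sum_(i < m.+1) shiftc d F i *m G (m - i)%N.
Proof.
case: d => //=; case: m => [|m] /=; first by rewrite big_ord1 mul0mx.
by rewrite big_ord_recl /= mul0mx add0r; apply: eq_bigr => i _.
Qed.

Lemma sh_conv' d F G m :
  shiftc d (convm F G) m = \sum_(i < m.+1) F i *m shiftc d G (m - i)%N.
Proof.
by rewrite sh_conv (sum_shift (f := mulmx)) // => ?; rewrite ?mul0mx ?mulmx0.
Qed.

Let Lval L s (v : int) : 'M[A]_n :=
  if v is Posz p then (if odd p then 0 else L s p./2) else 0.

Let LvalE L s (i k : int) :
  Lcoef L s (i - k) =
  Lval L s ((if s then i else - i) - (if s then k else - k)).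
Proof. by rewrite /Lcoef /Lval; case: s; rewrite // opprB opprK addrC. Qed.

Let raisesE s (k : int) : k \in ([:: 1; -1] : seq int) ->
  ((if s then k else - k) \in ([:: 1; -1] : seq int)) /\
  raises s k = ((if s then k else - k) == 1).
Proof. by rewrite !inE => /orP[] /eqP ->; case: s. Qed.

Let Lval_odd L s (a : nat) (k : int) : k \in ([:: 1; -1] : seq int) ->
  Lval L s ((a.*2)%:Z - 1 - k) = shiftc (k == 1) (L s) a.
Proof.
rewrite !inE => /orP[] /eqP ->; last first.
  have -> : (a.*2)%:Z - 1 - (-1) = (a.*2)%:Z by rewrite opprK subrK.
  by rewrite /Lval odd_double doubleK.
case: a => [//|a].
have -> : (a.+1.*2)%:Z - 1 - 1 = (a.*2)%:Z by rewrite doubleS; lia.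
by rewrite /Lval /= odd_double doubleK.
Qed.

Let Lval_even L s (i k : int) : (forall a : nat, i != (a.*2)%:Z - 1) ->
  k \in ([:: 1; -1] : seq int) -> Lval L s (i - k) = 0.
Proof.
move=> ni kE; rewrite /Lval; case E: (i - k) => [p|] //; case: ifP => // po.
have pE : p = p./2.*2 by rewrite -[LHS]odd_double_half po.
exfalso; move: kE; rewrite !inE => /orP[] /eqP kE; subst k.
  move/eqP: (ni p./2.+1); apply; rewrite doubleS -pE; lia.
move/eqP: (ni p./2); apply; rewrite -pE; lia.
Qed.

Lemma Lcoef_sh s (i : int) :
  (forall L k, k \in ([:: 1; -1] : seq int) -> Lcoef L s (i - k) = 0) \/
  (exists a : nat, forall L k, k \in ([:: 1; -1] : seq int) ->
     Lcoef L s (i - k) = shiftc (raises s k) (L s) a).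
Proof.
have [[a ia]|na] :=
    EM (exists a : nat, (if s then i else - i) = (a.*2)%:Z - 1).
  right; exists a => L k /(raisesE s)[kE ->]; rewrite LvalE ia; exact: Lval_odd.
left=> L k /(raisesE s)[kE _]; rewrite LvalE; apply: Lval_even => // a.
by apply/eqP => ia; apply: na; exists a.
Qed.

Lemma sh_Lcoef s (a : nat) : exists i : int,
  forall L k, k \in ([:: 1; -1] : seq int) ->
     Lcoef L s (i - k) = shiftc (raises s k) (L s) a.
Proof.
exists (if s then (a.*2)%:Z - 1 else - ((a.*2)%:Z - 1)) => L k /(raisesE s)[kE ->].
rewrite LvalE; have -> : (if s then if s then (a.*2)%:Z - 1
    else - ((a.*2)%:Z - 1) else - (if s then (a.*2)%:Z - 1
    else - ((a.*2)%:Z - 1))) = (a.*2)%:Z - 1 by clear kE; case: s; rewrite ?opprK.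
exact: Lval_odd.
Qed.

(* The exchange relations in terms of the coefficients of z^(2 s a) w^(2 s' b)
   after clearing the odd powers. *)
Definition RTTn L s s' : Prop := forall a b : nat,
  \sum_(k <- [:: 1; -1] : seq int)
    RA n q A k *m emb1 (shiftc (raises s k) (L s) a)
      *m emb2 (shiftc (raises s' (- k)) (L s') b) =
  \sum_(k <- [:: 1; -1] : seq int)
    emb2 (shiftc (raises s' (- k)) (L s') b)
      *m emb1 (shiftc (raises s k) (L s) a) *m RA n q A k.

Let memN (k : int) : k \in ([:: 1; -1] : seq int) ->
  - k \in ([:: 1; -1] : seq int).
Proof. by rewrite !inE => /orP[] /eqP ->. Qed.

Lemma RTT_RTTn L s s' :
  (forall i j, RLL q L s s' i j = LLR q L s s' i j) -> RTTn L s s'.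
Proof.
move=> H a b; have [i Hi] := sh_Lcoef s a; have [j Hj] := sh_Lcoef s' b.
have := H i j; rewrite /RLL /LLR.
rewrite big_seq [X in _ = X -> _]big_seq [X in _ -> X = _]big_seq.
rewrite [X in _ -> _ = X]big_seq.
have E k : k \in ([:: 1; -1] : seq int) ->
    Lcoef L s' (j + k) = shiftc (raises s' (- k)) (L s') b.
  by move=> kE; rewrite -Hj ?memN // opprK.
by under eq_bigr => k kE do rewrite Hi // E //;
   under [X in _ = X -> _]eq_bigr => k kE do rewrite Hi // E //.
Qed.

Lemma RTTn_RTT L s s' :
  RTTn L s s' -> forall i j, RLL q L s s' i j = LLR q L s s' i j.
Proof.
move=> H i j; rewrite /RLL /LLR big_seq [RHS]big_seq.
have [Z|[a Ha]] := Lcoef_sh s i.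
  by rewrite !big1 // => k kE; rewrite Z // raddf0 ?mulmx0 ?mul0mx.
have [Z|[b Hb]] := Lcoef_sh s' j.
  have E k : k \in ([:: 1; -1] : seq int) -> Lcoef L s' (j + k) = 0.
    by move=> kE; rewrite -[k]opprK Z ?memN.
  by rewrite !big1 // => k kE; rewrite E // raddf0 ?mulmx0 ?mul0mx.
have E k : k \in ([:: 1; -1] : seq int) ->
    Lcoef L s' (j + k) = shiftc (raises s' (- k)) (L s') b.
  by move=> kE; rewrite -[k in j + k]opprK Hb ?memN.
have := H a b; rewrite big_seq [X in _ = X -> _]big_seq => h.
under eq_bigr => k kE do rewrite Ha // E //.
by under [RHS]eq_bigr => k kE do rewrite Ha // E //.
Qed.

Variables P Q : bool -> nat -> 'M[A]_n.
Hypothesis PQ : forall s s' l m a b c d,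
  P s l a b * Q s' m c d = Q s' m c d * P s l a b.

Let T s := convm (P s) (Q s).

Let shPQ d d' s s' l m a b c e :
  shiftc d (P s) l a b * shiftc d' (Q s') m c e = shiftc d' (Q s') m c e * shiftc d (P s) l a b.
Proof.
by case: d; case: d'; case: l => [|l]; case: m => [|m]; rewrite /shiftc;
  rewrite ?[(0 : 'M_n) _ _]mxE ?mul0r ?mulr0 //; apply: PQ.
Qed.

Lemma RTTn_conv s s' : RTTn P s s' -> RTTn Q s s' -> RTTn T s s'.
Proof.
move=> HP HQ a b.
pose R := RA n q A.
pose S (k : int) := (raises s k, raises s' (- k)).
transitivity (\sum_(i < a.+1) \sum_(j < b.+1)
  (\sum_(k <- [:: 1; -1] : seq int)
     R k *m emb1 (shiftc (S k).1 (P s) i) *m emb2 (shiftc (S k).2 (P s') j))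
  *m emb1 (Q s (a - i)%N) *m emb2 (Q s' (b - j)%N)).
  under [RHS]eq_bigr => i _ do (under eq_bigr => j _ do
    rewrite !mulmx_suml).
  under [RHS]eq_bigr => i _ do rewrite exchange_big /=.
  rewrite [RHS]exchange_big /=; apply: eq_bigr => k _.
  rewrite !sh_conv emb1_sum mulmx_sumr mulmx_suml.
  apply: eq_bigr => i _; rewrite emb2_sum mulmx_sumr; apply: eq_bigr => j _.
  rewrite emb1M emb2M -!mulmxA; congr (_ *m (_ *m _)).
  rewrite !mulmxA; congr (_ *m _).
  by apply: emb12C => *; rewrite (shPQ _ false).
transitivity (\sum_(i < a.+1) \sum_(j < b.+1)
  (\sum_(k <- [:: 1; -1] : seq int)
     emb2 (shiftc (S k).2 (P s') j) *m emb1 (shiftc (S k).1 (P s) i) *m R k)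
  *m emb1 (Q s (a - i)%N) *m emb2 (Q s' (b - j)%N)).
  by apply: eq_bigr => i _; apply: eq_bigr => j _; rewrite HP.
transitivity (\sum_(i < a.+1) \sum_(j < b.+1)
  emb2 (P s' j) *m emb1 (P s i) *m
  (\sum_(k <- [:: 1; -1] : seq int)
     R k *m emb1 (shiftc (S k).1 (Q s) (a - i)%N)
       *m emb2 (shiftc (S k).2 (Q s') (b - j)%N))).
  under eq_bigr => i _ do (under eq_bigr => j _ do rewrite !mulmx_suml).
  under eq_bigr => i _ do rewrite exchange_big /=.
  under [RHS]eq_bigr => i _ do (under eq_bigr => j _ do rewrite !mulmx_sumr).
  under [RHS]eq_bigr => i _ do rewrite exchange_big /=.
  rewrite exchange_big [RHS]exchange_big /=; apply: eq_bigr => k _.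
  pose g (X : 'M[A]_n) (Y : 'M[A]_n) (j : nat) d :=
    \sum_(j < b.+1) emb2 (shiftc d (P s') j) *m emb1 X *m R k *m emb1 Y
       *m emb2 (shiftc (~~ d && (S k).2) (Q s') (b - j)%N).
  transitivity (\sum_(i < a.+1) \sum_(j < b.+1)
     emb2 (shiftc (S k).2 (P s') j) *m emb1 (P s i) *m R k
     *m emb1 (shiftc (S k).1 (Q s) (a - i)%N) *m emb2 (Q s' (b - j)%N)).
    rewrite exchange_big [RHS]exchange_big; apply: eq_bigr => j _ /=.
    apply: (sum_shift (f := fun X Y => emb2 (shiftc (S k).2 (P s') j) *m emb1 X
      *m R k *m emb1 Y *m emb2 (Q s' (b - j)%N))) => X;
    by rewrite raddf0 ?mulmx0 ?mul0mx // !mul0mx.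
  apply: eq_bigr => i _.
  rewrite (sum_shift (f := fun X Y => emb2 X *m emb1 (P s i)
      *m R k *m emb1 (shiftc (S k).1 (Q s) (a - i)%N) *m emb2 Y)) => [|X|X].
  - by apply: eq_bigr => j _; rewrite !mulmxA.
  - by rewrite raddf0 !mul0mx.
  - by rewrite raddf0 mulmx0.
transitivity (\sum_(i < a.+1) \sum_(j < b.+1)
  emb2 (P s' j) *m emb1 (P s i) *m
  (\sum_(k <- [:: 1; -1] : seq int)
     emb2 (shiftc (S k).2 (Q s') (b - j)%N) *m
       emb1 (shiftc (S k).1 (Q s) (a - i)%N) *m R k)).
  by apply: eq_bigr => i _; apply: eq_bigr => j _; rewrite HQ.
under eq_bigr => i _ do (under eq_bigr => j _ do rewrite !mulmx_sumr).
under eq_bigr => i _ do rewrite exchange_big /=.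
rewrite exchange_big /=; apply: eq_bigr => k _.
rewrite exchange_big !sh_conv' emb1_sum emb2_sum !mulmx_suml.
apply: eq_bigr => j _; rewrite mulmx_sumr mulmx_suml; apply: eq_bigr => i _.
rewrite emb1M emb2M -!mulmxA; congr (_ *m _).
rewrite !mulmxA; congr (_ *m _ *m _).
by apply: emb12C => *; rewrite (shPQ false).
Qed.

End Conv.
Local Notation U := (Uq n q).

(* Delta(L^(s m)_ab): coefficient of z^(s 2m) in
   \sum_c L^s_ac(z) (x) L^s_cb(z). *)
Definition coprod_gen (s : bool) (m : nat) : 'M[tens U U]_n :=
  \matrix_(a, b) \sum_(i < m.+1) \sum_c
    pure (Lgen n q s i a c) (Lgen n q s (m - i)%N c b).

Lemma coprod_relP x : Uq_rel q coprod_gen x -> x = 0.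
Proof.
pose P s m := map_mx (inl_tens U) (Lgen n q s m).
pose Q s m := map_mx (inr_tens U) (Lgen n q s m).
have genE s m : coprod_gen s m = convm (P s) (Q s) m.
  apply/matrixP => a b; rewrite summxE mxE; apply: eq_bigr => i _.
  rewrite mxE; apply: eq_bigr => c _.
  by rewrite [P _ _ _ _]mxE [Q _ _ _ _]mxE inlr_tens.
have PQ s s' l m a b c d :
    P s l a b * Q s' m c d = Q s' m c d * P s l a b.
  by rewrite !mxE inlr_tens inrl_tens.
have HP y : Uq_rel q P y -> y = 0.
  by case/Uq_rel_map_inv => z /LgenP ->; rewrite rmorph0.
have HQ y : Uq_rel q Q y -> y = 0.
  by case/Uq_rel_map_inv => z /LgenP ->; rewrite rmorph0.
have RTT (L : bool -> nat -> 'M[tens U U]_n) s s' i j :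
    (s, s') \in [:: (true, true); (false, false); (true, false)] ->
    (forall y, Uq_rel q L y -> y = 0) -> RLL q L s s' i j = LLR q L s s' i j.
  move=> ss' HL; apply/eqP; rewrite -subr_eq0; apply/eqP/matrixP => u v.
  by rewrite [RHS]mxE; apply: HL; apply: UqRTT.
have T0 s a b : coprod_gen s 0 a b = \sum_c P s 0%N a c * Q s 0%N c b.
  by rewrite genE /convm big_ord1 mxE.
have low (L : bool -> nat -> 'M[tens U U]_n) (a b : 'I_n) :
    (forall y, Uq_rel q L y -> y = 0) -> (a < b)%N ->
    L true 0%N a b = 0 /\ L false 0%N b a = 0.
  by move=> HL ab; split; apply: HL; [exact: UqLow|exact: UqUp].
have inv (L : bool -> nat -> 'M[tens U U]_n) s (a : 'I_n) :
    (forall y, Uq_rel q L y -> y = 0) -> L s 0%N a a * L (~~ s) 0%N a a = 1.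
  move=> HL; apply/eqP; rewrite -subr_eq0; apply/eqP; apply: HL.
  by case: s; [exact: UqInvr|exact: UqInvl].
have diag s a : coprod_gen s 0 a a = P s 0%N a a * Q s 0%N a a.
  rewrite T0 (bigD1 a) // big1 => [|c]; first exact: addr0.
  rewrite -val_eqE neq_ltn; case: s => /orP[] ac.
  - by move: (low Q _ _ HQ ac) => [-> _]; rewrite mulr0.
  - by move: (low P _ _ HP ac) => [-> _]; rewrite mul0r.
  - by move: (low P _ _ HP ac) => [_ ->]; rewrite mul0r.
  - by move: (low Q _ _ HQ ac) => [_ ->]; rewrite mulr0.
have gg s a : coprod_gen s 0 a a * coprod_gen (~~ s) 0 a a = 1.
  rewrite !diag -mulrA (mulrA (Q s _ _ _)) -PQ -mulrA inv // mulr1.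
  exact: inv.
case=> [s s' i j u v ss'|a b ab|a b ab|a|a].
- suff -> : RLL q coprod_gen s s' i j = LLR q coprod_gen s s' i j.
    by rewrite subrr mxE.
  have -> : coprod_gen = fun s => convm (P s) (Q s).
    by apply/funext => t; apply/funext => m; apply: genE.
  apply: (RTTn_RTT (L := fun s => convm (P s) (Q s))).
  apply: (RTTn_conv PQ); apply: RTT_RTTn => i' j'; exact: RTT.
- rewrite T0 big1 // => c _; case: (ltnP a c) => ac.
    by rewrite (low P _ _ HP ac).1 mul0r.
  by rewrite (low Q _ _ HQ (leq_ltn_trans ac ab)).1 mulr0.
- rewrite T0 big1 // => c _; case: (ltnP a c) => ac.
    by rewrite (low Q _ _ HQ ac).2 mulr0.
  by rewrite (low P _ _ HP (leq_ltn_trans ac ab)).2 mul0r.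
- by rewrite (gg true) subrr.
- by rewrite (gg false) subrr.
Qed.

Definition coprod : {lrmorphism U -> tens U U} := Uq_lift coprod_relP.

Lemma coprodE s m a b :
  coprod (Lgen n q s m a b) =
  \sum_(i < m.+1) \sum_c pure (Lgen n q s i a c) (Lgen n q s (m - i)%N c b).
Proof. by rewrite /coprod Uq_liftE mxE. Qed.

(* tpowS k is the tensor power of k + 1 copies of U. *)
Fixpoint tpowS (k : nat) : augAlgType K :=
  if k is k'.+1 then tens (tpowS k') U else U.

(* Iterated coproduct, with values in the tensor power of k + 1 copies:
   it is (Delta^(k) (x) id) o Delta. *)
Fixpoint coprodS (k : nat) : {lrmorphism U -> tpowS k} :=
  match k return {lrmorphism U -> tpowS k} with
  | 0 => idfun
  | k'.+1 => tens_map (coprodS k') idfun \o coprod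
  end.

Lemma coprodSE k s m a b :
  coprodS k.+1 (Lgen n q s m a b) =
  \sum_(i < m.+1) \sum_c
    pure (coprodS k (Lgen n q s i a c)) (Lgen n q s (m - i)%N c b).
Proof.
rewrite -[LHS]/(tens_map (coprodS k) idfun (coprod _)) coprodE raddf_sum.
apply: eq_bigr => i _; rewrite raddf_sum; apply: eq_bigr => c _.
exact: tens_mapE.
Qed.

(* Only used for N > 0. *)
Definition tpow (N : nat) : augAlgType K := tpowS N.-1.
Definition coprodN (N : nat) : {lrmorphism U -> tpow N} := coprodS N.-1.

(* A formal series in z^2 (if s) or z^-2 (if ~~ s) is given by the sequence of
   its coefficients, that of z^(s 2m) being indexed by m. *)
Definition monodromy (N : nat) (s : bool) (m : nat) : 'M[tpow N]_n :=
  map_mx (coprodN N) (Lgen n q s m).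
Definition transfer (N : nat) (s : bool) (m : nat) : tpow N :=
  \tr (monodromy N s m).

(* T(z) = L_01(z) L_02(z) ... L_0N(z), by induction on the number of copies. *)
Lemma monodromyS k s m :
  monodromy k.+2 s m =
  convm (fun i => map_mx (inl_tens U) (monodromy k.+1 s i))
        (fun i => map_mx (inr_tens (tpow k.+1)) (Lgen n q s i)) m.
Proof.
apply/matrixP => a b; rewrite mxE summxE [LHS]coprodSE.
apply: eq_bigr => i _; rewrite mxE; apply: eq_bigr => c _.
rewrite [X in _ = X * _]mxE [X in _ = _ * X]mxE inlr_tens.
by rewrite [X in _ = pure X _]mxE.
Qed.

(* l^s_ab; note the exchange of signs l^- = L^(+0), l^+ = L^(-0). *)
Definition lgen (s : bool) : 'M[U]_n := Lgen n q (~~ s) 0.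
Definition cartan (N : nat) (s : bool) (i : 'I_n) : tpow N :=
  coprodN N (lgen s i i).

End Coproduct.

Arguments monodromy {K} n q N s m.
Arguments transfer {K} n q N s m.
Arguments cartan {K n} q N s i.

Definition commutator (A : pzRingType) (x y : A) : A := x * y - y * x.

(* Unital subalgebra generated by S. *)
Inductive subalg_gen (K : fieldType) (A : algType K) (S : A -> Prop) :
    A -> Prop :=
| subalg_gen_in x of S x : subalg_gen S x
| subalg_gen1 : subalg_gen S 1
| subalg_genZ k x of subalg_gen S x : subalg_gen S (k *: x)
| subalg_genD x y of subalg_gen S x & subalg_gen S y : subalg_gen S (x + y)
| subalg_genM x y of subalg_gen S x & subalg_gen S y : subalg_gen S (x * y).

(* Subalgebra generated by the Cartan generators l^+_ii, l^-_ii. *)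
Definition cartan_subalg (K : fieldType) (n : nat) (q : K) (N : nat) :
    tpow n q N -> Prop :=
  subalg_gen (fun x => exists s i, x = cartan q N s i).

(* Main.v *)
(* The extreme degrees of the exchange relations involve a single coefficient
   R^± of R(z/w).  In the entry ((i,j),(i,j)) of R^± X_1 Y_2 = Y_2 X_1 R^±, the
   off-diagonal terms of R^± only bring in entries of the level-zero matrix
   that vanish by triangularity, so X_ii and Y_jj commute for all i, j: the
   Cartan generators commute with each diagonal entry of L^±(z) separately.
   Everything is then transported by the algebra morphism Delta^(N). *)

Require Import Defs.
From mathcomp Require Import all_boot all_order all_algebra.
From mathcomp Require Import complex reals.
From mathcomp Require Import zify mxtens.

Set Implicit Arguments.
Unset Strict Implicit.
Unset Printing Implicit Defensive.

Import GRing.Theory.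

Local Open Scope ring_scope.
Local Open Scope complex_scope.

(** * Entries of the coefficients of R, and exchange relations with a single coefficient *)

Section RMatrix.
Variables (K : fieldType) (n : nat) (q : K).

Definition Rdiag (t : int) (i j : 'I_n) : K :=
  if i == j then acoef q t else bcoef K t.
Definition Roff (t : int) (i j : 'I_n) : K :=
  (q - q^-1) * ((i != j) && (t == sgz (j%:Z - i%:Z)))%:R.

(** Row (i, j) of R only meets the columns (i, j) and (j, i). For i = j these two coincide, but
    [Roff] is then zero, so nothing is counted twice. *)
Lemma RcoefE t (i j k l : 'I_n) :
  Rcoef n q t (mxtens_index (i, j)) (mxtens_index (k, l)) =
  Rdiag t i j *+ ((i == k) && (j == l)) + Roff t i j *+ ((i == l) && (j == k)).
Proof.
(* Kronecker deltas collapse each of the three sums of R to a = i, and the inner sums to b = j; the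
   remaining equalities of indices stay as booleans. *)
have sum1 c (F G : 'I_n -> K) :
    (forall b, G b = F b *+ (c == b)) -> \sum_b G b = F c.
  move=> GF; rewrite (bigD1 c) //= GF eqxx big1 ?addr0 // => b bc.
  by rewrite GF eq_sym (negPf bc).
rewrite /Rcoef !mxE /Rdiag /Roff !summxE.
have -> : \sum_(a < n) (delta_mx a a *t delta_mx a a : 'M[K]_(n * n))
    (mxtens_index (i, j)) (mxtens_index (k, l)) =
    ((i == j) && (i == k) && (j == l))%:R.
  apply: (sum1 i (fun a => ((a == j) && (a == k) && (j == l))%:R)) => a.
  rewrite tensmxE !mxE -natrM mulnb -mulrnA mulnb.
  rewrite [k == a]eq_sym [j == a]eq_sym [l == a]eq_sym.
  congr (_ *+ nat_of_bool _).
  have [->|] := eqVneq a j; rewrite ?andbF //=.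
  by case: (i == j); case: (j == k); case: (j == l).
have -> : \sum_(a < n) (\sum_(b < n | a != b) delta_mx a a *t delta_mx b b : 'M[K]_(n * n))
    (mxtens_index (i, j)) (mxtens_index (k, l)) =
    ((i != j) && (i == k) && (j == l))%:R.
  apply: (sum1 i (fun a => ((a != j) && (a == k) && (j == l))%:R)) => a.
  rewrite summxE big_mkcond /= -mulrnA mulnb.
  apply: (sum1 j (fun b => ((a != b) && (a == k) && (b == l) && (i == a))%:R)) => b.
  rewrite tensmxE !mxE -natrM mulnb -!mulrnA !mulnb [k == a]eq_sym [l == b]eq_sym.
  by case: (i == a); case: (a == k); case: (j == b); case: (b == l);
    case: (a == b).
have -> : \sum_(a < n) (\sum_(b < n | a != b) (t == sgz (b%:Z - a%:Z))%:R *: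
      (delta_mx a b *t delta_mx b a) : 'M[K]_(n * n))
    (mxtens_index (i, j)) (mxtens_index (k, l)) =
    ((i != j) && (t == sgz (j%:Z - i%:Z)) && (i == l) && (j == k))%:R.
  apply: (sum1 i (fun a =>
    ((a != j) && (t == sgz (j%:Z - a%:Z)) && (a == l) && (j == k))%:R)) => a.
  rewrite summxE big_mkcond /= -mulrnA mulnb.
  apply: (sum1 j (fun b => ((a != b) && (t == sgz (b%:Z - a%:Z)) &&
    (a == l) && (b == k) && (i == a))%:R)) => b.
  rewrite mxE tensmxE !mxE -!natrM !mulnb -!mulrnA !mulnb.
  rewrite [k == b]eq_sym [l == a]eq_sym.
  by case: (i == a); case: (b == k); case: (j == b); case: (a == l);
    case: (a == b); case: (t == _).
have [ij|ij] := eqVneq i j.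
  by rewrite /= !mulr0 mul0rn !addr0 mulr_natr.
by rewrite /= mulr0 add0r mulr_natr -[X in _ = _ + X]mulr_natr -mulrA -natrM mulnb andbA.
Qed.

Variable A : algType K.
Implicit Types (X Y : 'M[A]_n) (M : 'M[A]_(n * n)).

Lemma mulRAmx t M (i j : 'I_n) y :
  (RA n q A t *m M) (mxtens_index (i, j)) y =
  Rdiag t i j *: M (mxtens_index (i, j)) y
  + Roff t i j *: M (mxtens_index (j, i)) y.
Proof.
rewrite mxE sum_mxtens.
under eq_bigr => k _ do under eq_bigr => l _ do
  rewrite mxE /= RcoefE -scalerAl mul1r scalerDl -!scalerMnl.
under eq_bigr => k _ do rewrite big_split.
rewrite big_split; congr (_ + _).
  rewrite (bigD1 i) //= [X in _ + X]big1 ?addr0 => [|k ki]; last first.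
    by rewrite big1 // => l _; rewrite eq_sym (negPf ki).
  rewrite (bigD1 j) //= big1 ?addr0 => [|l lj].
    by rewrite !eqxx.
  by rewrite [j == l]eq_sym (negPf lj) andbF.
rewrite (bigD1 j) //= [X in _ + X]big1 ?addr0 => [|k kj]; last first.
  by rewrite big1 // => l _; rewrite [j == k]eq_sym (negPf kj) andbF.
rewrite (bigD1 i) //= big1 ?addr0 => [|l li].
  by rewrite !eqxx.
by rewrite eq_sym (negPf li).
Qed.

Lemma mulmxRA t M x (k l : 'I_n) :
  (M *m RA n q A t) x (mxtens_index (k, l)) =
  Rdiag t k l *: M x (mxtens_index (k, l))
  + Roff t l k *: M x (mxtens_index (l, k)).
Proof.
rewrite mxE sum_mxtens.
under eq_bigr => i _ do under eq_bigr => j _ do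
  rewrite mxE /= RcoefE -scalerAr mulr1 scalerDl -!scalerMnl.
under eq_bigr => i _ do rewrite big_split.
rewrite big_split; congr (_ + _).
  rewrite (bigD1 k) //= [X in _ + X]big1 ?addr0 => [|i ik]; last first.
    by rewrite big1 // => j _; rewrite (negPf ik).
  rewrite (bigD1 l) //= big1 ?addr0 => [|j jl].
    by rewrite !eqxx.
  by rewrite (negPf jl) andbF.
rewrite (bigD1 l) //= [X in _ + X]big1 ?addr0 => [|i il]; last first.
  by rewrite big1 // => j _; rewrite (negPf il).
rewrite (bigD1 k) //= big1 ?addr0 => [|j jk].
  by rewrite !eqxx.
by rewrite (negPf jk) andbF.
Qed.

Lemma emb1_mul_emb2E X Y (i j k l : 'I_n) :
  (emb1 X *m emb2 Y) (mxtens_index (i, j)) (mxtens_index (k, l)) =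
  X i k * Y j l.
Proof.
rewrite mxE sum_mxtens (bigD1 k) //= [X in _ + X]big1 ?addr0 => [|a ak].
  rewrite (bigD1 j) //= big1 ?addr0 => [|b bj]; rewrite !tensmxE !mxE.
    by rewrite !eqxx mulr1 mul1r.
  by rewrite [j == b]eq_sym (negPf bj) mulr0 mul0r.
by rewrite big1 // => b _; rewrite !tensmxE !mxE (negPf ak) mul0r mulr0.
Qed.

Lemma emb2_mul_emb1E X Y (i j k l : 'I_n) :
  (emb2 Y *m emb1 X) (mxtens_index (i, j)) (mxtens_index (k, l)) =
  Y j l * X i k.
Proof.
rewrite mxE sum_mxtens (bigD1 i) //= [X in _ + X]big1 ?addr0 => [|a ai].
  rewrite (bigD1 l) //= big1 ?addr0 => [|b bl]; rewrite !tensmxE !mxE.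
    by rewrite !eqxx mulr1 mul1r.
  by rewrite (negPf bl) !mulr0.
by rewrite big1 // => b _; rewrite !tensmxE !mxE eq_sym (negPf ai) !mul0r.
Qed.

(** What is left of an RTT relation when only the power (z/w)^t of R(z/w) contributes. *)
Definition exchange t X Y : Prop :=
  RA n q A t *m emb1 X *m emb2 Y = emb2 Y *m emb1 X *m RA n q A t.

(** Each relation of [RTTn] has just two terms per side, for (z/w)^1 and (z/w)^-1, so a zero factor
    in one of them leaves the other to hold alone. The zero will come from [shiftc true] at index 0,
    as no coefficient precedes the constant one. *)
Lemma RTTn_exchange (L : bool -> nat -> 'M[A]_n) s s' a b :
  RTTn q L s s' ->
  (shiftc s (L s) a = 0 \/ shiftc (~~ s') (L s') b = 0 ->
   exchange (-1) (shiftc (~~ s) (L s) a) (shiftc s' (L s') b)) /\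
  (shiftc (~~ s) (L s) a = 0 \/ shiftc s' (L s') b = 0 ->
   exchange 1 (shiftc s (L s) a) (shiftc (~~ s') (L s') b)).
Proof.
move=> /(_ a b); rewrite !big_cons !big_nil !addr0 opprK /raises.
have -> : (s == (1 == 1 :> int)) = s by case: s.
have -> : (s == (-1 == 1 :> int)) = ~~ s by case: s.
have -> : (s' == (1 == 1 :> int)) = s' by case: s'.
have -> : (s' == (-1 == 1 :> int)) = ~~ s' by case: s'.
rewrite /exchange; move: (shiftc s _ a) (shiftc (~~ s) _ a) => X X'.
move: (shiftc s' _ b) (shiftc (~~ s') _ b) => Y' Y E.
have e1 : emb1 (0 : 'M[A]_n) = 0 by exact: raddf0.
have e2 : emb2 (0 : 'M[A]_n) = 0 by exact: raddf0.
by split=> -[] Z; move: E; rewrite Z ?e1 ?e2 ?(mulmx0, mul0mx) ?(addr0, add0r).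
Qed.

Lemma exchange_diag_comm t X Y (i j : 'I_n) :
  q != 0 -> t \in ([:: 1; -1] : seq int) ->
  exchange t X Y ->
  Roff t i j *: (X j i * Y i j) = 0 -> Roff t j i *: (Y j i * X i j) = 0 ->
  X i i * Y j j = Y j j * X i i.
Proof.
move=> q0 tE RXY XY0 YX0.
(* This scalar is q or -q^-1 when i = j, and 1 or -1 otherwise, so it can be cancelled. *)
have d0 : Rdiag t i j != 0.
  rewrite /Rdiag /acoef /bcoef; move: tE; rewrite !inE => /orP[]/eqP->;
  by case: (i == j); rewrite /= ?subr0 ?sub0r ?oppr_eq0 ?invr_eq0 ?oner_eq0.
apply: (scalerI d0).
have := congr1 (fun M : 'M_(n * n) =>
  M (mxtens_index (i, j)) (mxtens_index (i, j))) RXY.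
rewrite -mulmxA mulRAmx mulmxRA !emb1_mul_emb2E !emb2_mul_emb1E.
by rewrite XY0 YX0 !addr0.
Qed.

End RMatrix.

(** * Commutation of the Cartan generators with the diagonal of the monodromy matrix *)

Section Cartan.
Variables (K : fieldType) (n : nat) (q : K).
Hypothesis q0 : q != 0.
Local Notation L := (Lgen n q).

Lemma Lgen0_trig (s : bool) (a b : 'I_n) :
  (if s then a < b else b < a)%N -> L s 0%N a b = 0.
Proof.
by case: s => ab; apply: LgenP; [exact: UqLow | exact: UqUp].
Qed.

Lemma Lgen_RTTn s s' :
  (s, s') \in [:: (true, true); (false, false); (true, false)] ->
  RTTn q L s s'.
Proof.
move=> ss'; apply: RTT_RTTn => i j.
apply/eqP; rewrite -subr_eq0; apply/eqP/matrixP => u v.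
by rewrite [RHS]mxE; apply: LgenP; apply: UqRTT.
Qed.

(** A nonzero [Roff] forces j < i at the power -1 and i < j at the power 1, which is where the
    triangular matrices of level zero vanish. The entry of opposite sign, with transposed indices,
    serves when the level-zero matrix sits in the second space. *)
Lemma Roff_Lgen0 (e : bool) (i j : 'I_n) :
  Roff q (if e then -1 else 1) i j = 0 \/
  L e 0%N j i = 0 /\ L (~~ e) 0%N i j = 0.
Proof.
rewrite /Roff; have [->|ij] := eqVneq i j; first by left; rewrite mulr0.
have [/eqP sgn_ij|] := boolP (_ == sgz _); last by left; rewrite mulr0.
by right; case: e sgn_ij => sgn_ij; split; apply: Lgen0_trig => /=; lia.
Qed.

Lemma Lgen_diag_comm (e s : bool) (m : nat) (i j : 'I_n) :
  L e 0%N i i * L s m j j = L s m j j * L e 0%N i i.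
Proof.
pose t e : int := if e then -1 else 1.
have offl e' (a b : 'I_n) (Y : Uq n q) :
    Roff q (t e') a b *: (L e' 0%N b a * Y) = 0.
  by case: (Roff_Lgen0 e' a b) => [->|[-> _]]; rewrite ?scale0r // mul0r scaler0.
have offr e' (a b : 'I_n) (Y : Uq n q) :
    Roff q (t e') a b *: (Y * L e' 0%N b a) = 0.
  by case: (Roff_Lgen0 e' a b) => [->|[-> _]]; rewrite ?scale0r // mulr0 scaler0.
(* The same cancellations for L^(-0) in the second space, still at the power -1. *)
have offl' (a b : 'I_n) (Y : Uq n q) :
    Roff q (t true) a b *: (L false 0%N a b * Y) = 0.
  by case: (Roff_Lgen0 true a b) => [->|[_ ->]]; rewrite ?scale0r // mul0r scaler0.
have offr' (a b : 'I_n) (Y : Uq n q) :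
    Roff q (t true) a b *: (Y * L false 0%N a b) = 0.
  by case: (Roff_Lgen0 true a b) => [->|[_ ->]]; rewrite ?scale0r // mulr0 scaler0.
case: e; case: s.
(* The index is m + 1 because the surviving term carries [shiftc true], which returns the
   coefficient m there. *)
- have [+ _] := RTTn_exchange 0%N m.+1 (@Lgen_RTTn true true isT).
  move=> /(_ (or_introl erefl)) E.
  by rewrite (exchange_diag_comm q0 _ E (offl true i j _) (offr true j i _)).
- have [+ _] := RTTn_exchange 0%N m (@Lgen_RTTn true false isT).
  move=> /(_ (or_introl erefl)) E.
  by rewrite (exchange_diag_comm q0 _ E (offl true i j _) (offr true j i _)).
(* The mixed relation has L^+ in the first space, so the level-zero L^- is now in the second one and
   i, j exchange roles. *)
- have [+ _] := RTTn_exchange m 0%N (@Lgen_RTTn true false isT).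
  move=> /(_ (or_intror erefl)) E.
  by rewrite (exchange_diag_comm q0 _ E (offr' j i _) (offl' i j _)).
- have [_ +] := RTTn_exchange 0%N m.+1 (@Lgen_RTTn false false isT).
  move=> /(_ (or_introl erefl)) E.
  by rewrite (exchange_diag_comm q0 _ E (offl false i j _) (offr false j i _)).
Qed.

Lemma cartan_diag_comm (N : nat) (e s : bool) (m : nat) (i j : 'I_n) :
  GRing.comm (cartan q N e i) (monodromy n q N s m j j).
Proof. by rewrite /GRing.comm mxE /cartan -!rmorphM Lgen_diag_comm. Qed.

Lemma cartan_transfer_comm (N : nat) (e s : bool) (m : nat) (i : 'I_n) :
  GRing.comm (cartan q N e i) (transfer n q N s m).
Proof. by apply: commr_sum => j _; apply: cartan_diag_comm. Qed.

(** Cartan generators are themselves images of diagonal entries, at m = 0. *)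
Lemma cartan_comm (N : nat) (e s : bool) (i j : 'I_n) :
  GRing.comm (cartan q N e i) (cartan q N s j).
Proof. by rewrite /GRing.comm /cartan -!rmorphM Lgen_diag_comm. Qed.

Lemma cartan_inv (N : nat) (i : 'I_n) :
  cartan q N true i * cartan q N false i = 1 /\
  cartan q N false i * cartan q N true i = 1.
Proof.
have inv (e : bool) : L e 0%N i i * L (~~ e) 0%N i i = 1.
  by apply/eqP; rewrite -subr_eq0; apply/eqP/LgenP; case: e;
    [exact: UqInvr | exact: UqInvl].
have cinv e : cartan q N e i * cartan q N (~~ e) i = 1.
  by rewrite /cartan /lgen -rmorphM inv rmorph1.
by split; [exact: (cinv true) | exact: (cinv false)].
Qed.

End Cartan.

(** * From the generators to the symmetry algebra *)

Lemma subalg_gen_comm (K : fieldType) (A : algType K) (S : A -> Prop) (y : A) :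
  (forall x, S x -> GRing.comm y x) ->
  forall x, subalg_gen S x -> GRing.comm y x.
Proof.
move=> Sy x; elim=> {x} [x /Sy //||k x _ IH|x x' _ IH _ IH'|x x' _ IH _ IH'].
- exact: commr1.
- by rewrite /GRing.comm -scalerAr -scalerAl IH.
- exact: commrD.
- exact: commrM.
Qed.

(** The identity between formal series is stated coefficient by coefficient. The abelian symmetry is
    expressed by invertible generators whose subalgebra is commutative and centralizes every
    coefficient of t(z). *)
Theorem mainTheorem1 (R : realType) (n N : nat) (q : R[i])
    (n_ge2 : (2 <= n)%N) (N_ge1 : (1 <= N)%N)
    (q_neq0 : q != 0) (q2_neq1 : q ^+ 2 != 1) :
  (forall (e s : bool) (i : 'I_n) (m : nat),
     commutator (cartan q N e i) (transfer n q N s m) = 0) /\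
  [/\ forall i : 'I_n,
        cartan q N true i * cartan q N false i = 1 /\
        cartan q N false i * cartan q N true i = 1,
      forall x y : tpow n q N, cartan_subalg x -> cartan_subalg y ->
        commutator x y = 0
    & forall (x : tpow n q N) (s : bool) (m : nat), cartan_subalg x ->
        commutator x (transfer n q N s m) = 0].
Proof.
have commE (x y : tpow n q N) : GRing.comm x y -> commutator x y = 0.
  by move=> xy; rewrite /commutator xy subrr.
split=> [e s i m|]; first exact/commE/cartan_transfer_comm.
split=> [i|x y Hx Hy|x s m Hx].
- exact: cartan_inv.
(* Centralizers are subalgebras: y is reduced to a generator first, then x. *)
- apply/commE; apply: subalg_gen_comm Hy => _ [s [j ->]]; apply: commr_sym.
  apply: subalg_gen_comm Hx => _ [e [i ->]]; exact: cartan_comm.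
- apply/commE/commr_sym; apply: subalg_gen_comm Hx => _ [e [i ->]].
  exact/commr_sym/cartan_transfer_comm.
Qed.
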